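(* Let $(\lambda_k)_{k\ge 1}$ be a sequence of real numbers with $\lambda_k>0$ for all $k\ge 1$, and let $\Lambda_n=\sum_{k=1}^n\lambda_k$ for $n\ge 1$. Suppose that $$M=\sup_{n\ge 1}\ \frac{\Lambda_n}{\lambda_n}\log\left(\frac{\Lambda_{n+1}/\lambda_{n+1}}{\Lambda_n/\lambda_n}\right)<+\infty .$$ Then for every sequence $(a_n)_{n\ge 1}$ of non-negative real numbers such that $\sum_{n=1}^\infty a_n$ converges, $$\sum_{n=1}^\infty G_n\le e^{M}\sum_{n=1}^\infty a_n,\qquad\text{where } G_n=\prod_{k=1}^n a_k^{\lambda_k/\Lambda_n}.$$
   Context: Here $\log$ is the natural logarithm. Since all terms are non-negative, the infinite sum $\sum_n G_n$ is understood as an element of $[0,+\infty]$. *)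

(* Defs.v *)
From mathcomp Require Export all_boot all_order all_algebra.
From mathcomp Require Export all_classical all_reals all_analysis.
Export Order.TTheory GRing.Theory Num.Theory numFieldNormedType.Exports.

Set Implicit Arguments.
Unset Strict Implicit.
Unset Printing Implicit Defensive.

Local Open Scope classical_set_scope.
Local Open Scope ring_scope.

(* Sequences are indexed from 1; the value at 0 of a function nat -> R
   representing one is junk that none of the definitions below inspects
   at an index n >= 1. *)

Section WeightedMeans.
Context {R : realType}.
Implicit Types lam a : nat -> R.

Definition Lam lam (n : nat) : R := \sum_(1 <= k < n.+1) lam k.

Definition logGrowthSup lam : \bar R :=
  ereal_sup
    [set (Lam lam n / lam n *
          ln ((Lam lam n.+1 / lam n.+1) / (Lam lam n / lam n)))%:E
    | n in [set n : nat | (1 <= n)%N]].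

Definition geoMean lam a (n : nat) : R :=
  \prod_(1 <= k < n.+1) (a k `^ (lam k / Lam lam n)).

End WeightedMeans.

(* Main.v *)
Require Import Defs.
From mathcomp Require Import ring lra.

(** This is Carleman's argument with general weights.  Write
    r_n = Lambda_n / lambda_n.  A direct use of the weighted AM-GM inequality
    on G_n loses too much, because the terms a_k may be very unequal; one
    balances them first by factors c_k > 0, which gives
      G_n <= (sum_(k <= n) lambda_k c_k a_k) / (Lambda_n C_n),
    where C_n is the weighted geometric mean of c_1, ..., c_n.  The c_k are
    chosen so that C_n = r_(n+1), because then the coefficient telescopes:
      1 / (Lambda_n C_n) = 1 / Lambda_n - 1 / Lambda_(n+1)
    ([geoMean_le_balanced]).  Summing over n and exchanging the sums leaves at
    most sum_k (lambda_k c_k / Lambda_k) a_k ([sum_geoMean_le]).  The choice of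
    C_n forces c_k = r_k (r_(k+1) / r_k) ^ r_k, so that
    lambda_k c_k / Lambda_k = exp (r_k log (r_(k+1) / r_k)), and the supremum of
    these exponents is M. *)

Local Open Scope classical_set_scope.
Local Open Scope ring_scope.

(** Multiply the tangent inequalities x_i / A <= exp (x_i / A - 1), raised to
    the powers w_i: the exponents on the right add up to
    (sum_i w_i x_i) / A - 1, which vanishes when A is the arithmetic mean.
    That mean may be 0, so A is taken slightly larger. *)
Lemma weighted_amgm (R : realType) (I : Type) (s : seq I) (P : pred I)
    (w x : I -> R) :
    (forall i, P i -> 0 <= w i) -> (forall i, P i -> 0 <= x i) ->
    \sum_(i <- s | P i) w i = 1 ->
  \prod_(i <- s | P i) x i `^ w i <= \sum_(i <- s | P i) w i * x i.
Proof.
move=> w0 x0 w1; apply/ler_addgt0Pr => e e0.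
set S := \sum_(i <- s | P i) w i * x i.
have S0 : 0 <= S by apply: sumr_ge0 => i Pi; rewrite mulr_ge0 ?w0 ?x0.
set A := S + e.
have A0 : 0 < A by rewrite ltr_wpDl.
apply: (@le_trans _ _
  (\prod_(i <- s | P i) expR (w i * (ln A + (x i / A - 1))))).
  apply: ler_prod => i Pi; rewrite powR_ge0 /=.
  have -> : expR (w i * (ln A + (x i / A - 1)))
            = (A * expR (x i / A - 1)) `^ w i.
    by rewrite mulrC expRM expRD lnK.
  rewrite ge0_ler_powR ?w0 ?nnegrE ?x0 ?mulr_ge0 ?expR_ge0 ?(ltW A0) //.
  rewrite -ler_pdivrMl // mulrC.
  by have := expR_ge1Dx (x i / A - 1); rewrite addrC subrK.
rewrite -expR_sum.
have -> : \sum_(i <- s | P i) w i * (ln A + (x i / A - 1))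
          = ln A + (S / A - 1).
  under eq_bigr do rewrite addrA addrAC mulrDr mulrA.
  rewrite big_split /= -!mulr_suml w1 mul1r -/S; ring.
rewrite expRD lnK // ger_pMr // -[leRHS]expR0 ler_expR subr_le0.
by rewrite ler_pdivrMr // mul1r /A lerDl ltW.
Qed.

Section Carleman.
Context {R : realType} (lam : nat -> R).
Hypothesis lam_gt0 : forall k : nat, (1 <= k)%N -> 0 < lam k.

Let ratio n := Lam lam n / lam n.

Let growth n := ratio n * ln (ratio n.+1 / ratio n).

Let balance k := ratio k * expR (growth k).

Lemma LamS n : Lam lam n.+1 = Lam lam n + lam n.+1.
Proof. by rewrite /Lam big_nat_recr. Qed.

Lemma Lam_gt0 n : (1 <= n)%N -> 0 < Lam lam n.
Proof.
case: n => // n _; rewrite LamS ltr_wpDl ?lam_gt0 //.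
by rewrite /Lam big_nat; apply: sumr_ge0 => k /andP[k1 _]; rewrite ltW ?lam_gt0.
Qed.

Lemma ratio_gt0 n : (1 <= n)%N -> 0 < ratio n.
Proof. by move=> n1; rewrite divr_gt0 ?Lam_gt0 ?lam_gt0. Qed.

Lemma balance_gt0 n : (1 <= n)%N -> 0 < balance n.
Proof. by move=> n1; rewrite mulr_gt0 ?ratio_gt0 ?expR_gt0. Qed.

(** The recurrence that determines the balancing factors from the requirement
    on their geometric means. *)
Lemma lam_ln_balance n :
  lam n.+1 * ln (balance n.+1)
  = Lam lam n.+1 * ln (ratio n.+2) - Lam lam n * ln (ratio n.+1).
Proof.
have l0 : lam n.+1 != 0 by rewrite gt_eqF ?lam_gt0.
rewrite /balance lnM ?posrE ?ratio_gt0 ?expR_gt0 // expRK /growth.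
rewrite ln_div ?posrE ?ratio_gt0 // mulrDr mulrA.
have -> : lam n.+1 * ratio n.+1 = Lam lam n.+1 by rewrite /ratio mulrC divfK.
rewrite LamS; ring.
Qed.

Lemma geoMean_balance n : (1 <= n)%N -> geoMean lam balance n = ratio n.+1.
Proof.
move=> n1.
have L0 : Lam lam n != 0 by rewrite gt_eqF ?Lam_gt0.
have sumE m : \sum_(1 <= k < m.+1) lam k * ln (balance k)
              = Lam lam m * ln (ratio m.+1).
  elim: m => [|m IH]; first by rewrite /Lam !big_geq // mul0r.
  by rewrite big_nat_recr //= IH lam_ln_balance addrC subrK.
rewrite /geoMean big_nat.
under eq_bigr => k /andP[k1 _].
  rewrite -[balance k]lnK ?posrE ?balance_gt0 // -expRM mulrCA mulrA.
  over.
rewrite -big_nat -expR_sum -mulr_suml sumE.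
by rewrite mulrAC divff // mul1r lnK // posrE ratio_gt0.
Qed.

Lemma geoMeanM a b n :
    (forall k, (1 <= k)%N -> 0 <= a k) -> (forall k, (1 <= k)%N -> 0 <= b k) ->
  geoMean lam (fun k => a k * b k) n = geoMean lam a n * geoMean lam b n.
Proof.
move=> a0 b0; rewrite /geoMean -big_split /=; apply: eq_big_nat => k /andP[k1 _].
by rewrite powRM ?a0 ?b0.
Qed.

Lemma geoMean_le_arithMean a n : (1 <= n)%N ->
    (forall k, (1 <= k)%N -> 0 <= a k) ->
  geoMean lam a n <= (\sum_(1 <= k < n.+1) lam k * a k) / Lam lam n.
Proof.
move=> n1 a0; rewrite /geoMean mulr_suml.
under [leRHS]eq_bigr do rewrite mulrAC.
rewrite big_nat [leRHS]big_nat; apply: weighted_amgm => [k|k|].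
- by move=> /andP[k1 _]; rewrite divr_ge0 ?ltW ?lam_gt0 ?Lam_gt0.
- by move=> /andP[k1 _]; rewrite a0.
- by rewrite -big_nat -mulr_suml divff // gt_eqF ?Lam_gt0.
Qed.

Variable a : nat -> R.
Hypothesis a_ge0 : forall k : nat, (1 <= k)%N -> 0 <= a k.

Let balancedSum n := \sum_(1 <= k < n.+1) lam k * (a k * balance k).

(** AM-GM for the balanced terms; the telescoping coefficient comes from
    1 / ratio n.+1 = (Lam n.+1 - Lam n) / Lam n.+1. *)
Lemma geoMean_le_balanced n : (1 <= n)%N ->
  geoMean lam a n <= balancedSum n * ((Lam lam n)^-1 - (Lam lam n.+1)^-1).
Proof.
move=> n1.
have b0 k : (1 <= k)%N -> 0 <= balance k by move=> k1; rewrite ltW ?balance_gt0.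
have -> : geoMean lam a n
          = geoMean lam (fun k => a k * balance k) n / ratio n.+1.
  by rewrite geoMeanM // geoMean_balance // mulfK // gt_eqF ?ratio_gt0.
rewrite ler_pdivrMr ?ratio_gt0 //.
have ab0 k : (1 <= k)%N -> 0 <= a k * balance k.
  by move=> k1; rewrite mulr_ge0 ?a_ge0 ?b0.
apply: (le_trans (geoMean_le_arithMean _ _ n1 ab0)).
rewrite -/(balancedSum n) le_eqVlt; apply/orP; left; apply/eqP.
have Ln : Lam lam n != 0 by rewrite gt_eqF ?Lam_gt0.
have := LamS n; have := Lam_gt0 n.+1 isT; have := lam_gt0 n.+1 isT.
rewrite /ratio => l0 L0 LE; rewrite LE in L0 *.
by field; rewrite Ln !gt_eqF.
Qed.

(** The boundary term balancedSum N / Lam N.+1 is what telescoping leaves; with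
    it on the left, exchanging the two summations becomes an induction on N. *)
Lemma sum_geoMean_balanced_le N :
  \sum_(1 <= n < N.+1) geoMean lam a n + balancedSum N / Lam lam N.+1
  <= \sum_(1 <= n < N.+1) expR (growth n) * a n.
Proof.
elim: N => [|N IH]; first by rewrite /balancedSum !big_geq // mul0r addr0.
rewrite !(big_nat_recr N.+1) //=.
have G := geoMean_le_balanced N.+1 isT.
have T : balancedSum N.+1 / Lam lam N.+1
         = balancedSum N / Lam lam N.+1 + expR (growth N.+1) * a N.+1.
  rewrite {1}/balancedSum big_nat_recr //= -/(balancedSum N) mulrDl.
  congr (_ + _); rewrite /balance /ratio.
  have := Lam_gt0 N.+1 isT; have := lam_gt0 N.+1 isT => l0 L0.
  by field; rewrite !gt_eqF.
rewrite mulrBr T in G; lra.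
Qed.

Lemma sum_geoMean_le N :
  \sum_(1 <= n < N.+1) geoMean lam a n
  <= \sum_(1 <= n < N.+1) expR (growth n) * a n.
Proof.
apply: le_trans (sum_geoMean_balanced_le N); rewrite lerDl.
rewrite divr_ge0 ?(ltW (Lam_gt0 _ _)) // /balancedSum big_nat.
apply: sumr_ge0 => k /andP[k1 _].
have /ltW l0 := lam_gt0 k k1; have /ltW b0 := balance_gt0 k k1.
by rewrite (mulr_ge0 l0) // (mulr_ge0 (a_ge0 k k1)).
Qed.

Lemma growth_le_logGrowthSup n : (1 <= n)%N ->
  ((growth n)%:E <= logGrowthSup lam)%E.
Proof. by move=> n1; apply: ereal_sup_ubound; exists n. Qed.

Lemma sum_geoMean_le_expR (m : R) N : logGrowthSup lam = m%:E ->
  \sum_(1 <= n < N.+1) geoMean lam a n <= expR m * \sum_(1 <= n < N.+1) a n.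
Proof.
move=> mE; apply: (le_trans (sum_geoMean_le N)).
rewrite mulr_sumr; apply: ler_sum_nat => n /andP[n1 _].
rewrite ler_wpM2r ?a_ge0 // ler_expR -lee_fin -mE.
exact: growth_le_logGrowthSup.
Qed.

End Carleman.

Theorem theorem1p2 (R : realType) (lam : nat -> R)
    (lam_gt0 : forall k : nat, (1 <= k)%N -> 0 < lam k)
    (M : \bar R) (M_def : M = logGrowthSup lam) (M_fin : (M < +oo)%E)
    (a : nat -> R)
    (a_ge0 : forall n : nat, (1 <= n)%N -> 0 <= a n)
    (a_cvg : cvgn (fun N : nat => \sum_(1 <= n < N.+1) a n)) :
  (\sum_(1 <= n <oo) (geoMean lam a n)%:E
     <= expeR M * \sum_(1 <= n <oo) (a n)%:E)%E.
Proof.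
have [m mE] : exists m : R, M = m%:E.
  have := growth_le_logGrowthSup lam 1 (leqnn 1); rewrite -M_def.
  by case: M M_fin {M_def} => [m _ _|//|//]; exists m.
rewrite mE /=; apply: lime_le.
  apply: is_cvg_nneseries => n _ _; rewrite lee_fin.
  by apply: prodr_ge0 => k _; exact: powR_ge0.
(* The partial sums up to an index N < 1 are empty, hence the shift by 1. *)
exists 1%N => // -[//|N] _ /=.
apply: (@le_trans _ _ ((expR m)%:E * \sum_(1 <= n < N.+1) (a n)%:E)%E).
  rewrite !sumEFin -EFinM lee_fin.
  by apply: sum_geoMean_le_expR => //; rewrite -M_def.
apply: lee_wpmul2l; first by rewrite lee_fin expR_ge0.
by apply: nneseries_lim_ge => n n1 _; rewrite lee_fin a_ge0.
Qed.
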